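(* For each of the four balancing schemes (AVL trees, red-black trees, weight-balanced trees, treaps), the work of $\mathrm{split}(T,k)$ (the generic algorithm in the context, using the scheme's join) is $O(\log|T|)$ (with high probability for treaps). The two resulting trees $T_l$ and $T_r$ have rank at most $r(T)$.
   Context: A binary tree is either $\mathrm{Leaf}$ or $\mathrm{Node}(L,k,R)$; $\mathrm{expose}(\mathrm{Node}(L,k,R))=(L,k,R)$; size $|T|$, weight $w(T)=|T|+1$, height $h(T)$. A binary search tree (BST) has keys from a total order with strictly increasing in-order sequence. Balancing schemes and ranks: AVL (children heights differ by at most one at every node; $r(T)=h(T)-1$); red-black (nodes red/black, leaves black, no red node has a red child, all downward paths to leaves have equal numbers of black nodes, root may be red; with $\mathrm{bh}(T)$ the number of black nodes on a downward root-to-leaf path including the root, $r(T)=2(\mathrm{bh}(T)-1)$ if the root is black and $2\mathrm{bh}(T)-1$ if red); $\alpha$ weight-balanced with $\frac{2}{11}<\alpha\le1-\frac1{\sqrt2}$ (every $T=\mathrm{Node}(L,v,R)$ has $\alpha\le w(L)/w(T)\le 1-\alpha$; $r(T)=\lceil\log_2w(T)\rceil-1$); treaps (independent uniformly random priorities, heap-ordered with highest priority at the root; $r(T)=\lceil\log_2w(T)\rceil-1$). For each scheme, $\mathrm{join}(T_l,k,T_r)$ (for BSTs with all keys of $T_l$ less than $k$ less than all keys of $T_r$) is the scheme-specific algorithm returning a balanced tree with in-order sequence $T_l,k,T_r$; it satisfies: for AVL, RB and WB trees it costs $O(|r(T_l)-r(T_r)|)$ work, for treaps $O(\log t)$ expected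 work when $k$ has the $t$-th highest priority among the keys, and in all cases the result $T$ has $\max(r(T_l),r(T_r))\le r(T)\le1+\max(r(T_l),r(T_r))$. (AVL join descends the right spine of the taller tree to a node of height at most $h(\text{shorter})+1$, attaches there and rebalances upwards with rotations; RB join descends to a black node of equal black height, attaches a red node and fixes red-red violations upward by recoloring and left rotations; WB join descends to a node of like weight and rebalances upward with single/double rotations; treap join recursively places the highest-priority key among $k$ and the two roots at the root.) $\mathrm{split}(T,k)$ returns $(T_l,b,T_r)$: if $T=\mathrm{Leaf}$ return $(\mathrm{Leaf},\mathrm{false},\mathrm{Leaf})$; else let $(L,m,R)=\mathrm{expose}(T)$; if $k=m$ return $(L,\mathrm{true},R)$; if $k<m$, let $(L_L,b,L_R)=\mathrm{split}(L,k)$ and return $(L_L,b,\mathrm{join}(L_R,m,R))$; else let $(R_L,b,R_R)=\mathrm{split}(R,k)$ and return $(\mathrm{join}(L,m,R_L),b,R_R)$. Work counts all operations; expose and node creation cost $O(1)$. ''With high probability'' means probability at least $1-N^{-c}$ for any constant $c>0$. *)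

(* Defs.v *)
From HB Require Import structures.
From mathcomp Require Import all_boot all_order all_algebra.
From mathcomp Require Import all_classical all_reals all_analysis.

Set Implicit Arguments.
Unset Strict Implicit.
Unset Printing Implicit Defensive.

Import Order.TTheory GRing.Theory Num.Theory.

Local Open Scope ring_scope.

(* Work is measured in a cost monad: a computation is a value paired with the
   number of elementary operations performed.  One unit is charged for each
   expose, each node creation, each comparison of keys or of priorities, and
   each inspection of the colour, height, black height or weight at the root
   of a tree (these are O(1), being stored in the nodes). *)
Definition M (A : Type) : Type := (A * nat)%type.
Definition value (A : Type) (m : M A) : A := m.1.
Definition work (A : Type) (m : M A) : nat := m.2.
Definition ret (A : Type) (a : A) : M A := (a, 0%N).
Definition bind (A B : Type) (m : M A) (f : A -> M B) : M B :=
  let r := f (value m) in (value r, (work m + work r)%N).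
Definition op (A : Type) (a : A) : M A := (a, 1%N).
Definition tick (n : nat) : M unit := (tt, n).

Notation "'let*' x ':=' m 'in' f" := (bind m (fun x => f))
  (at level 200, x name, m at level 100, f at level 200, right associativity).

(* [D] is the type of the balancing data attached to a node besides its key:
   the colour for red-black trees, [unit] for the other schemes. *)
Inductive tree (D K : Type) : Type :=
| Leaf
| Node of tree D K & D & K & tree D K.
Arguments Leaf {D K}.
Arguments Node {D K} l d k r.

Section Trees.
Variables D K : Type.
Implicit Types t : tree D K.

Definition node (l : tree D K) (d : D) (k : K) (r : tree D K) : M (tree D K) :=
  op (Node l d k r).

Fixpoint tree_size t : nat :=
  if t is Node l _ _ r then (tree_size l + tree_size r).+1 else 0%N.

Definition weight t : nat := (tree_size t).+1.

Fixpoint height t : nat :=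
  if t is Node l _ _ r then (maxn (height l) (height r)).+1 else 0%N.

Fixpoint inorder t : seq K :=
  if t is Node l _ k r then inorder l ++ k :: inorder r else [::].

(* Rotations move each key together with its balancing data.  They perform two
   exposes and two node creations; they are only ever called on trees of the
   shape matched by the first branch. *)
Definition rotate_left t : M (tree D K) :=
  match t with
  | Node a dx x (Node b dy y c) =>
      let* _ := tick 2 in
      let* l := node a dx x b in
      node l dy y c
  | _ => ret t
  end.

Definition rotate_right t : M (tree D K) :=
  match t with
  | Node (Node a dx x b) dy y c =>
      let* _ := tick 2 in
      let* r := node b dy y c in
      node a dx x r
  | _ => ret t
  end.

End Trees.

Definition bst (disp : Order.disp_t) (K : orderType disp) (D : Type)
  (t : tree D K) : bool := sorted <%O (inorder t).

Fixpoint tree_split (disp : Order.disp_t) (K : orderType disp) (D : Type)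
    (join : tree D K -> K -> tree D K -> M (tree D K))
    (t : tree D K) (k : K) {struct t} : M (tree D K * bool * tree D K) :=
  match t with
  | Leaf => let* _ := tick 1 in ret (Leaf, false, Leaf)
  | Node l _ m r =>
      let* _ := tick 1 in
      let* eq := op (k == m) in
      if eq then ret (l, true, r) else
      let* lt := op (k < m)%O in
      if lt then
        let* res := tree_split join l k in
        let: (ll, b, lr) := res in
        let* tr := join lr m r in
        ret (ll, b, tr)
      else
        let* res := tree_split join r k in
        let: (rl, b, rr) := res in
        let* tl := join l m rl in
        ret (tl, b, rr)
  end.

Section AVL.
Variable K : Type.
Implicit Types t : tree unit K.

Fixpoint avl t : bool :=
  if t is Node l _ _ r then
    [&& (height l <= (height r).+1)%N, (height r <= (height l).+1)%N,
        avl l & avl r]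
  else true.

Definition avl_rank t : int := (height t)%:Z - 1.

(* In [avl_join_right] and [avl_join_left] the Leaf case is never reached. *)
Fixpoint avl_join_right (tl : tree unit K) (k : K) (tr : tree unit K)
    {struct tl} : M (tree unit K) :=
  match tl with
  | Leaf => node Leaf tt k tr
  | Node l _ k' c =>
      let* _ := tick 1 in
      let* hc := op (height c) in
      let* hr := op (height tr) in
      let* hl := op (height l) in
      if (hc <= hr.+1)%N then
        let* t' := node c tt k tr in
        let* h' := op (height t') in
        if (h' <= hl.+1)%N then node l tt k' t' else
        let* t'' := rotate_right t' in
        let* u := node l tt k' t'' in
        rotate_left u
      else
        let* t' := avl_join_right c k tr in
        let* h' := op (height t') in
        let* u := node l tt k' t' in
        if (h' <= hl.+1)%N then ret u else rotate_left u
  end.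

Fixpoint avl_join_left (tl : tree unit K) (k : K) (tr : tree unit K)
    {struct tr} : M (tree unit K) :=
  match tr with
  | Leaf => node tl tt k Leaf
  | Node c _ k' r =>
      let* _ := tick 1 in
      let* hc := op (height c) in
      let* hl := op (height tl) in
      let* hr := op (height r) in
      if (hc <= hl.+1)%N then
        let* t' := node tl tt k c in
        let* h' := op (height t') in
        if (h' <= hr.+1)%N then node t' tt k' r else
        let* t'' := rotate_left t' in
        let* u := node t'' tt k' r in
        rotate_right u
      else
        let* t' := avl_join_left tl k c in
        let* h' := op (height t') in
        let* u := node t' tt k' r in
        if (h' <= hr.+1)%N then ret u else rotate_right u
  end.

Definition avl_join (tl : tree unit K) (k : K) (tr : tree unit K) :
    M (tree unit K) :=
  let* hl := op (height tl) in
  let* hr := op (height tr) in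
  if (hr.+1 < hl)%N then avl_join_right tl k tr
  else if (hl.+1 < hr)%N then avl_join_left tl k tr
  else node tl tt k tr.

End AVL.

Inductive color : Type := Red | Black.

Section RedBlack.
Variable K : Type.
Implicit Types t : tree color K.

Definition is_red t : bool := if t is Node _ Red _ _ then true else false.

(* Black nodes on the leftmost root-to-leaf path, root and (black) leaf
   included; in a red-black tree all paths give the same number. *)
Fixpoint bh t : nat :=
  if t is Node l c _ _ then
    (if c is Black then (bh l).+1 else bh l)
  else 1%N.

Fixpoint rb t : bool :=
  if t is Node l c _ r then
    [&& (if c is Red then ~~ is_red l && ~~ is_red r else true),
        bh l == bh r, rb l & rb r]
  else true.

Definition rb_rank t : int :=
  if is_red t then 2 * (bh t)%:Z - 1 else 2 * ((bh t)%:Z - 1).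

Definition blacken t : M (tree color K) :=
  if t is Node l _ k r then let* _ := tick 1 in node l Black k r else ret t.

Definition left_of t : tree color K := if t is Node l _ _ _ then l else Leaf.
Definition right_of t : tree color K := if t is Node _ _ _ r then r else Leaf.

Definition blacken_right t : M (tree color K) :=
  if t is Node l c k r then
    let* _ := tick 1 in let* r' := blacken r in node l c k r'
  else ret t.

Definition blacken_left t : M (tree color K) :=
  if t is Node l c k r then
    let* _ := tick 1 in let* l' := blacken l in node l' c k r
  else ret t.

Fixpoint rb_join_right (tl : tree color K) (k : K) (tr : tree color K)
    {struct tl} : M (tree color K) :=
  let* red := op (is_red tl) in
  let* bl := op (bh tl) in
  let* br := op (bh tr) in
  if ~~ red && (bl == br) then node tl Red k tr else
  match tl with
  | Leaf => node tl Red k tr (* never reached *)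
  | Node l' c' k' r' =>
      let* _ := tick 1 in
      let* t' := rb_join_right r' k tr in
      let* red1 := op (is_red t') in
      let* red2 := op (is_red (right_of t')) in
      if (if c' is Black then red1 && red2 else false) then
        let* t'' := blacken_right t' in
        let* u := node l' c' k' t'' in
        rotate_left u
      else node l' c' k' t'
  end.

Fixpoint rb_join_left (tl : tree color K) (k : K) (tr : tree color K)
    {struct tr} : M (tree color K) :=
  let* red := op (is_red tr) in
  let* bl := op (bh tl) in
  let* br := op (bh tr) in
  if ~~ red && (bl == br) then node tl Red k tr else
  match tr with
  | Leaf => node tl Red k tr (* never reached *)
  | Node l' c' k' r' =>
      let* _ := tick 1 in
      let* t' := rb_join_left tl k l' in
      let* red1 := op (is_red t') in
      let* red2 := op (is_red (left_of t')) in
      if (if c' is Black then red1 && red2 else false) then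
        let* t'' := blacken_left t' in
        let* u := node t'' c' k' r' in
        rotate_right u
      else node t' c' k' r'
  end.

Definition rb_join (tl : tree color K) (k : K) (tr : tree color K) :
    M (tree color K) :=
  let* bl := op (bh tl) in
  let* br := op (bh tr) in
  let* redl := op (is_red tl) in
  let* redr := op (is_red tr) in
  if (br < bl)%N then
    let* t' := rb_join_right tl k tr in
    let* red1 := op (is_red t') in
    let* red2 := op (is_red (right_of t')) in
    if red1 && red2 then blacken t' else ret t'
  else if (bl < br)%N then
    let* t' := rb_join_left tl k tr in
    let* red1 := op (is_red t') in
    let* red2 := op (is_red (left_of t')) in
    if red1 && red2 then blacken t' else ret t'
  else if ~~ redl && ~~ redr then node tl Red k tr
  else node tl Black k tr.

End RedBlack.

(* ceil(log_2 w(T)) - 1, the rank used for weight-balanced trees and treaps *)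
Definition log_rank (D K : Type) (t : tree D K) : int :=
  (up_log 2 (weight t))%:Z - 1.

Section WeightBalanced.
Variables (R : realType) (alpha : R) (K : Type).
Implicit Types t : tree unit K.

Fixpoint wb t : bool :=
  if t is Node l _ _ r then
    [&& alpha <= (weight l)%:R / (weight t)%:R <= 1 - alpha, wb l & wb r]
  else true.

(* Two sibling trees of weights [w1] and [w2] are in balance; the weight of a
   node is the sum of the weights of its children. *)
Definition like (w1 w2 : nat) : bool :=
  alpha <= w1%:R / (w1 + w2)%:R <= 1 - alpha.

Fixpoint wb_join_right (tl : tree unit K) (k : K) (tr : tree unit K)
    {struct tl} : M (tree unit K) :=
  let* wl := op (weight tl) in
  let* wr := op (weight tr) in
  if like wl wr then node tl tt k tr else
  match tl with
  | Leaf => node tl tt k tr (* never reached *)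
  | Node l _ k' c =>
      let* _ := tick 1 in
      let* t' := wb_join_right c k tr in
      let* w := op (weight l) in
      let* w' := op (weight t') in
      if like w w' then node l tt k' t' else
      match t' with
      | Leaf => node l tt k' t' (* never reached *)
      | Node l1 _ k1 r1 =>
          let* _ := tick 1 in
          let* w1 := op (weight l1) in
          let* w2 := op (weight r1) in
          if like w w1 && like (w + w1) w2 then
            let* u := node l tt k' t' in
            rotate_left u
          else
            let* t'' := rotate_right t' in
            let* u := node l tt k' t'' in
            rotate_left u
      end
  end.

Fixpoint wb_join_left (tl : tree unit K) (k : K) (tr : tree unit K)
    {struct tr} : M (tree unit K) :=
  let* wl := op (weight tl) in
  let* wr := op (weight tr) in
  if like wl wr then node tl tt k tr else
  match tr with
  | Leaf => node tl tt k tr (* never reached *)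
  | Node c _ k' r =>
      let* _ := tick 1 in
      let* t' := wb_join_left tl k c in
      let* w := op (weight r) in
      let* w' := op (weight t') in
      if like w' w then node t' tt k' r else
      match t' with
      | Leaf => node t' tt k' r (* never reached *)
      | Node l1 _ k1 r1 =>
          let* _ := tick 1 in
          let* w1 := op (weight r1) in
          let* w2 := op (weight l1) in
          if like w1 w && like w2 (w1 + w) then
            let* u := node t' tt k' r in
            rotate_right u
          else
            let* t'' := rotate_left t' in
            let* u := node t'' tt k' r in
            rotate_right u
      end
  end.

Definition wb_join (tl : tree unit K) (k : K) (tr : tree unit K) :
    M (tree unit K) :=
  let* wl := op (weight tl) in
  let* wr := op (weight tr) in
  if like wl wr then node tl tt k tr
  else if (wr < wl)%N then wb_join_right tl k tr
  else wb_join_left tl k tr.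

End WeightBalanced.

Section Treap.
Variables (R : realType) (K : Type) (p : K -> R).
Implicit Types t : tree unit K.

Fixpoint treap t : bool :=
  if t is Node l _ k r then
    [&& all (fun x => p x <= p k) (inorder l ++ inorder r), treap l & treap r]
  else true.

Definition prior (k : K) t : bool :=
  if t is Node _ _ x _ then p x <= p k else true.

Fixpoint treap_join (t1 : tree unit K) (k : K) {struct t1} :
    tree unit K -> M (tree unit K) :=
  fix join1 (t2 : tree unit K) {struct t2} : M (tree unit K) :=
    let* b1 := op (prior k t1) in
    let* b2 := op (prior k t2) in
    if b1 && b2 then node t1 tt k t2 else
    match t1, t2 with
    | Leaf, Leaf => node t1 tt k t2 (* never reached *)
    | Node l1 _ k1 r1, Leaf =>
        let* _ := tick 1 in
        let* r := treap_join r1 k t2 in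
        node l1 tt k1 r
    | Leaf, Node l2 _ k2 r2 =>
        let* _ := tick 1 in
        let* l := join1 l2 in
        node l tt k2 r2
    | Node l1 _ k1 r1, Node l2 _ k2 r2 =>
        let* _ := tick 2 in
        let* b := op (p k2 <= p k1) in
        if b then
          let* r := treap_join r1 k t2 in
          node l1 tt k1 r
        else
          let* l := join1 l2 in
          node l tt k2 r2
    end.

End Treap.

Section Randomness.
Local Open Scope classical_set_scope.
Local Open Scope ereal_scope.
Context (d : measure_display) (Omega : measurableType d) (R : realType).
Variables (P : probability Omega R) (I : eqType).

Definition uniform01 (X : {RV P >-> R}) : Prop :=
  forall A : set R, measurable A ->
    distribution P X A = uniform_prob (@ltr01 R) A.

Definition mutually_independent (s : seq I) (X : I -> {RV P >-> R}) : Prop :=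
  forall J : seq I, uniq J -> {subset J <= s} ->
  forall B : I -> set R, (forall i, i \in J -> measurable (B i)) ->
    P (\big[setI/setT]_(i <- J) (X i @^-1` B i)) =
    \big[*%E/1]_(i <- J) P (X i @^-1` B i).

End Randomness.

(* The constants of the O(log |t|) bound depend neither on the key type nor on
   the tree. *)
Definition split_log_work (R : realType) (D : Type)
    (ok : forall K : Type, tree D K -> bool)
    (join : forall K : Type, tree D K -> K -> tree D K -> M (tree D K)) :
    Prop :=
  exists (C : R) (n0 : nat),
    forall (disp : Order.disp_t) (K : orderType disp) (t : tree D K) (k : K),
      bst t -> ok K t -> (n0 <= tree_size t)%N ->
      (work (tree_split (join K) t k))%:R <= C * ln (tree_size t)%:R.

Definition split_rank_le (disp : Order.disp_t) (K : orderType disp) (D : Type)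
    (join : tree D K -> K -> tree D K -> M (tree D K)) (rank : tree D K -> int)
    (t : tree D K) (k : K) : Prop :=
  let: (tl, _, tr) := value (tree_split join t k) in
  rank tl <= rank t /\ rank tr <= rank t.

(* Main.v *)
Require Import Defs.
From HB Require Import structures.
From mathcomp Require Import all_boot all_order all_algebra.
From mathcomp Require Import all_classical all_reals all_analysis.
From mathcomp Require Import zify ring lra.

Set Implicit Arguments.
Unset Strict Implicit.
Unset Printing Implicit Defensive.

Import Order.TTheory GRing.Theory Num.Theory.

Local Open Scope classical_set_scope.
Local Open Scope ring_scope.

(** A join performed by split always combines a tree [u] that came out of the
    recursive call with an original subtree [r] of [t], and [u] is never
    larger than the sibling of [r]. Hence the join only descends into [r],
    never into a tree produced by an earlier join: balance of the
    intermediate results is not needed, only bounds on a potential [psi]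
    (the height, the red-black rank, the logarithm of the weight). The join
    costs [O(psi r - psi u + 1)] and its result has potential at least [psi
    r], so the costs telescope along the search path.

    In a treap every such join is immediate, since the key [m] has the
    highest priority, and the cost is the length of the search path. The
    nodes of that path on either side of [k] are weak records of the
    priorities read away from [k]. Only the levels [1 - 2^-l <= x] are
    observed: each counted record raises the level with probability 1/2, so
    [E[(4/3)^records 2^-level] <= 1], while reaching level [L] has
    probability at most [n 2^-L]. *)

(** * Amortized cost of the generic split against an abstract potential *)

Section AmortizedSplit.
Variables (V : realDomainType) (disp : Order.disp_t) (K : orderType disp).
Variables (D : Type) (join : tree D K -> K -> tree D K -> M (tree D K)).
Variables (ok : tree D K -> bool) (psi : tree D K -> V) (c c' : V).
Hypothesis c_ge0 : 0 <= c.
Hypothesis c'_ge0 : 0 <= c'.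
Hypothesis psi_ge0 : forall t, 0 <= psi t.
Hypothesis ok_children : forall l d m r, ok (Node l d m r) ->
  [/\ ok l, ok r, psi l <= psi (Node l d m r) & psi r <= psi (Node l d m r)].

Hypothesis join_into_right : forall l d m r u, ok (Node l d m r) ->
  psi u <= psi l -> let j := join u m r in
  psi (value j) <= psi (Node l d m r) /\
  (work j)%:R + c * psi u <= c * psi (value j) + c'.
Hypothesis join_into_left : forall l d m r u, ok (Node l d m r) ->
  psi u <= psi r -> let j := join l m u in
  psi (value j) <= psi (Node l d m r) /\
  (work j)%:R + c * psi u <= c * psi (value j) + c'.

(** On each side of [k] the result of one join is the [u] of the next, so the charges
    [c * (psi j - psi u)] telescope to the potentials of the two outputs. A level costs [c'] for its
    join and 3 for the expose and the two comparisons. *)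
Lemma split_amortized (t : tree D K) (k : K) : ok t ->
  let: (tl, _, tr) := value (tree_split join t k) in
  [/\ psi tl <= psi t, psi tr <= psi t &
      (work (tree_split join t k))%:R <=
      1 + (c' + 3) * (height t)%:R + c * (psi tl + psi tr)].
Proof.
elim: t => [|l IHl d m r IHr] okt.
  split=> //; rewrite /work /= mulr0 addr0.
  by rewrite lerDl mulr_ge0 ?addr_ge0.
have [okl okr pl pr] := ok_children okt.
have c'0 : 0 <= c' := c'_ge0.
have c3 : 0 <= c' + 3 by rewrite addr_ge0.
rewrite /= /bind /=; set h := (maxn _ _).+1.
have hl : (c' + 3) * ((height l)%:R + 1) <= (c' + 3) * h%:R.
  by rewrite ler_wpM2l // natr1 ler_nat ltnS leq_maxl.
have hr : (c' + 3) * ((height r)%:R + 1) <= (c' + 3) * h%:R.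
  by rewrite ler_wpM2l // natr1 ler_nat ltnS leq_maxr.
move: h hl hr => h hl hr; move: (IHl okl) (IHr okr) => {IHl IHr}.
case: (k == m) => /= [_ _|].
  split=> //; rewrite /work /= -[(1 + _)%N]/2%N.
  have : 0 <= (c' + 3) * (height l)%:R by rewrite mulr_ge0.
  have : 0 <= c * (psi l + psi r) by rewrite mulr_ge0 ?addr_ge0.
  by lra.
case: (k < m)%O => /=.
  case: (tree_split join l k) => [[[ll b] lr] w] /= [pll plr hw] _.
  have [pj wj] := join_into_right okt plr.
  split=> //; first exact: le_trans pll pl.
  move: hw wj; rewrite /work /= addn0 !natrD.
  by lra.
move=> _; case: (tree_split join r k) => [[[rl b] rr] w] /= [prl prr hw].
have [pj wj] := join_into_left okt prl.
split=> //; first exact: le_trans prr pr.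
move: hw wj; rewrite /work /= addn0 !natrD.
by lra.
Qed.

End AmortizedSplit.

(** * Computation rules for values and costs in the monad *)

#[local] Arguments bind : simpl never.
#[local] Arguments value : simpl never.
#[local] Arguments work : simpl never.

Lemma work_bind (A B : Type) (m : M A) (f : A -> M B) :
  work (bind m f) = (work m + work (f (value m)))%N.
Proof. by []. Qed.

Lemma value_bind (A B : Type) (m : M A) (f : A -> M B) :
  value (bind m f) = value (f (value m)).
Proof. by []. Qed.

Lemma work_op (A : Type) (a : A) : work (op a) = 1%N. Proof. by []. Qed.
Lemma work_ret (A : Type) (a : A) : work (ret a) = 0%N. Proof. by []. Qed.
Lemma work_tick n : work (tick n) = n. Proof. by []. Qed.
Lemma value_op (A : Type) (a : A) : value (op a) = a. Proof. by []. Qed.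
Lemma value_ret (A : Type) (a : A) : value (ret a) = a. Proof. by []. Qed.
Lemma work_node (D K : Type) (l : tree D K) d k r : work (node l d k r) = 1%N.
Proof. by []. Qed.
Lemma value_node (D K : Type) (l : tree D K) d k r :
  value (node l d k r) = Node l d k r.
Proof. by []. Qed.
Definition costE := (work_node, value_node, work_bind, value_bind, work_op,
  work_ret, work_tick, value_op, value_ret).

(** * Rotations, sizes and weights *)

Section Rotations.
Variables D K : Type.
Implicit Types t : tree D K.

Lemma work_rotate_left t : (work (rotate_left t) <= 4)%N.
Proof. by case: t => [|a dx x [|b dy y c]]. Qed.

Lemma work_rotate_right t : (work (rotate_right t) <= 4)%N.
Proof. by case: t => [|[|a dx x b] dy y c]. Qed.

Lemma inorder_rotate_left t : inorder (value (rotate_left t)) = inorder t.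
Proof. by case: t => [|a dx x [|b dy y c]] //=; rewrite -catA. Qed.

Lemma inorder_rotate_right t : inorder (value (rotate_right t)) = inorder t.
Proof. by case: t => [|[|a dx x b] dy y c] //=; rewrite -catA. Qed.

Lemma size_inorder t : size (inorder t) = tree_size t.
Proof.
by elim: t => //= l IHl d k r IHr; rewrite size_cat /= IHl IHr addnS.
Qed.

Lemma weight_node (l : tree D K) d k r :
  weight (Node l d k r) = (weight l + weight r)%N.
Proof. by rewrite /weight /= addnS. Qed.

End Rotations.

(** * AVL trees, with the height as potential *)

Section AVL.
Variable K : Type.
Implicit Types t : tree unit K.

(** Only the height of the result is tracked, and a rotation keeps it within these bounds whichever
    grandchild is the taller one. A level of the descent costs at most 10 and lowers the height; the
    level where it ends costs at most 15. *)
Lemma avl_join_left_spec (tl : tree unit K) k tr :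
  avl tr -> ((height tl).+1 < height tr)%N ->
  let j := avl_join_left tl k tr in
  [/\ (height tr <= height (value j))%N, (height (value j) <= (height tr).+1)%N
    & (work j + 10 * height tl <= 10 * height tr + 15)%N].
Proof.
elim: tr => [//|c IHc [] k' r _] /= /and4P[hcr hrc ac ar] hlt.
rewrite !costE; case: ifP => hcl; rewrite !costE.
  case: ifP => h'.
    by move: h'; rewrite ?costE /= => h'; split; lia.
  (* If [c] were a leaf, [tl] would be one too and [t'] would have height 1, so no rotation would be
     called for. *)
  case: c hcr hrc ac {IHc} hlt hcl h' => [|c1 [] x c2] /=; first by lia.
  by move=> hcr hrc ac hlt hcl h'; rewrite ?costE /=; split; lia.
have [//||hj1 hj2 hw] := IHc; first by lia.
case: ifP => h'; rewrite ?costE /=; first by split; lia.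
move: (avl_join_left tl k c) hj1 hj2 hw h' => [[|a [] x b] w];
  rewrite /value /work /= => hj1 hj2 hw h'; first by lia.
by rewrite ?costE; split; lia.
Qed.

Lemma avl_join_right_spec tl k (tr : tree unit K) :
  avl tl -> ((height tr).+1 < height tl)%N ->
  let j := avl_join_right tl k tr in
  [/\ (height tl <= height (value j))%N, (height (value j) <= (height tl).+1)%N
    & (work j + 10 * height tr <= 10 * height tl + 15)%N].
Proof.
elim: tl => [//|l _ [] k' c IHc] /= /and4P[hcr hrc al ac] hlt.
rewrite !costE; case: ifP => hcl; rewrite !costE.
  case: ifP => h'.
    by move: h'; rewrite ?costE /= => h'; split; lia.
  case: c hcr hrc ac {IHc} hlt hcl h' => [|c1 [] x c2] /=; first by lia.
  by move=> hcr hrc ac hlt hcl h'; rewrite ?costE /=; split; lia.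
have [//||hj1 hj2 hw] := IHc; first by lia.
case: ifP => h'; rewrite ?costE /=; first by split; lia.
move: (avl_join_right c k tr) hj1 hj2 hw h' => [[|a [] x b] w];
  rewrite /value /work /= => hj1 hj2 hw h'; first by lia.
by rewrite ?costE; split; lia.
Qed.

(** Both children of a node of height [h] have height at least [h - 2], so the weight doubles at
    least every two levels. *)
Lemma avl_height t n : avl t -> (n.*2 <= height t)%N -> (2 ^ n <= weight t)%N.
Proof.
elim: n t => [|n IHn] [|l [] k r] //= /and4P[hlr hrl al ar] hn.
rewrite weight_node expnS.
have := IHn _ al; have := IHn _ ar; lia.
Qed.

End AVL.

Lemma avl_split_bound (disp : Order.disp_t) (K : orderType disp)
    (t : tree unit K) (k : K) : avl t ->
  let: (tl, _, tr) := value (tree_split (@avl_join K) t k) in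
  [/\ (height tl <= height t)%N, (height tr <= height t)%N &
    (work (tree_split (@avl_join K) t k) <= 1 + 60 * height t)%N].
Proof.
(* 10 is the cost of a level of the descent; 27 leaves room for the 15 of its last level and the
   reads in [avl_join]. The total slope, 27 + 3 + 2 * 10, is below 60. *)
have := @split_amortized int disp K unit (@avl_join K) (@avl K)
  (fun u => (height u)%:Z) 10 27 isT isT.
move=> /(_ (fun=> isT)) H.
move=> okt; have := H _ _ _ t k okt.
case: (tree_split _ _ _) => [[[tl b] tr] w] /=.
rewrite /work /= => {}H; case: H.
- by move=> l d m r /= /and4P[]; split=> //; lia.
- move=> l d m r u /= /and4P[hlr hrl al ar] hu.
  (* Descending into [u] is excluded by [height u <= height l <= (height r).+1]. *)
  rewrite /avl_join !costE; case: ifP => h1; first by lia.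
  case: ifP => h2; last by rewrite /= ?costE /=; split; lia.
  by have [] := @avl_join_left_spec _ u m r ar h2 => h3 h4 h5; split; lia.
- move=> l d m r u /= /and4P[hlr hrl al ar] hu.
  rewrite /avl_join !costE; case: ifP => h1.
    by have [] := @avl_join_right_spec _ l m u al h1 => h3 h4 h5; split; lia.
  case: ifP => h2; first by lia.
  by rewrite /= ?costE /=; split; lia.
- by move=> h1 h2 h3; split; lia.
Qed.

(** * Red-black trees, with the rank as potential *)

Section RedBlack.
Variable K : Type.
Implicit Types t : tree color K.

Lemma bh_gt0 t : (0 < bh t)%N.
Proof. by elim: t => //= l IHl [] k r IHr. Qed.

Lemma work_blacken t : (work (blacken t) <= 2)%N.
Proof. by case: t. Qed.

Lemma bh_blacken t : is_red t ->
  bh (value (blacken t)) = (bh t).+1 /\ ~~ is_red (value (blacken t)).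
Proof. by case: t => //= l []. Qed.

(** A level costs at most 15 and no two consecutive nodes are red, hence 30 per unit of black height
    and 15 more for a red root. The second conclusion confines the final blackening in [rb_join] to
    a red [tr]. *)
Lemma rb_join_left_spec (tl : tree color K) k tr :
  rb tr -> (bh tl <= bh tr)%N ->
  let j := rb_join_left tl k tr in
  [/\ bh (value j) = bh tr,
      ~~ is_red tr -> (bh tl < bh tr)%N ->
        ~~ (is_red (value j) && is_red (left_of (value j)))
    & (work j + 30 * bh tl <= 30 * bh tr + 15 * is_red tr + 4)%N].
Proof.
have bh0 := bh_gt0 tl; elim: tr => [|l IHl c k' r _].
  move=> _ /= h; have -> : bh tl = 1%N by lia.
  by rewrite !costE /= ?costE; split=> //=; lia.
move=> /= /and4P[hred /eqP hbh rbl rbr] hle; rewrite !costE.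
case: ifP => [/andP[hr /eqP heq]|hstop]; rewrite ?costE.
  by split=> //=; lia.
have [||hj hd hw] := IHl => //.
  (* The black height drops only below a black root, and where the descent passes one,
     [bh tl < bh tr]. *)
  by case: c hred hle hstop => //= _; lia.
case: ifP => hrr; rewrite ?costE; last first.
  case: c hred hle hstop hrr => /= hred hle hstop hrr; split=> //=.
  - by case/andP: hred hw => /negbTE-> _; lia.
  - by rewrite hj.
  - by case: (is_red l) hw; lia.
case: c hred hle hstop hrr => //= hred hle hstop.
(* The rotation brings up a red node with two black children; the blackened grandchild restores the
   black height. *)
move: (rb_join_left tl k l) hj hd hw => [[|[|x1 [] x x2] [] y b] w] //.
rewrite /value /work /= => hj _ hw _; rewrite ?costE; split=> //=.
- by rewrite -hj.
- by case: (is_red l) hw; lia.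
Qed.

Lemma rb_join_right_spec tl k (tr : tree color K) :
  rb tl -> (bh tr <= bh tl)%N ->
  let j := rb_join_right tl k tr in
  [/\ bh (value j) = bh tl,
      ~~ is_red tl -> (bh tr < bh tl)%N ->
        ~~ (is_red (value j) && is_red (right_of (value j)))
    & (work j + 30 * bh tr <= 30 * bh tl + 15 * is_red tl + 4)%N].
Proof.
have bh0 := bh_gt0 tr; elim: tl => [|l _ c k' r IHr].
  move=> _ /= h; have -> : bh tr = 1%N by lia.
  by rewrite !costE /= ?costE; split=> //=; lia.
move=> /= /and4P[hred /eqP hbh rbl rbr] hle; rewrite !costE.
case: ifP => [/andP[hr /eqP heq]|hstop]; rewrite ?costE.
  by split=> //=; lia.
have [||hj hd hw] := IHr => //.
  by case: c hred hle hstop => //= _; lia.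
case: ifP => hrr; rewrite ?costE; last first.
  case: c hred hle hstop hrr => /= hred hle hstop hrr; split=> //=.
  - by case/andP: hred hw => _ /negbTE->; lia.
  - by case: (is_red r) hw; lia.
case: c hred hle hstop hrr => //= hred hle hstop.
move: (rb_join_right r k tr) hj hd hw => [[|b [] y [|x1 [] x x2]] w] //.
rewrite /value /work /= => hj _ hw _; rewrite ?costE; split=> //=.
by case: (is_red r) hw; lia.
Qed.

Lemma rb_rankE t : rb_rank t = (2 * (bh t)%:Z - 2 + (is_red t)%:Z)%R.
Proof. by rewrite /rb_rank; case: is_red; lia. Qed.

(** Each step up raises the rank by at least one: a red node has black children, and a black node
    raises [bh]. *)
Lemma rb_height t : rb t -> (height t)%:Z <= rb_rank t.
Proof.
rewrite rb_rankE; elim: t => //= l IHl c k r IHr /and4P[hred /eqP hbh rbl rbr].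
move: (IHl rbl) (IHr rbr); case: c hred => /=.
  by move=> /andP[/negbTE-> /negbTE->]; lia.
by case: (is_red l); case: (is_red r); lia.
Qed.

Lemma rb_weight t : rb t -> (2 ^ (bh t).-1 <= weight t)%N.
Proof.
elim: t => //= l IHl c k r IHr /and4P[_ /eqP hbh rbl rbr].
rewrite weight_node; move: (IHl rbl) (IHr rbr); rewrite -hbh.
case: c => /=; first by lia.
by case: (bh l) (bh_gt0 l) => // b _; rewrite expnS /=; lia.
Qed.

End RedBlack.

Lemma rb_split_bound (disp : Order.disp_t) (K : orderType disp)
    (t : tree color K) (k : K) : rb t ->
  let: (tl, _, tr) := value (tree_split (@rb_join K) t k) in
  [/\ rb_rank tl <= rb_rank t, rb_rank tr <= rb_rank t &
    (work (tree_split (@rb_join K) t k))%:Z <= 1 + 133 * rb_rank t].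
Proof.
(* 15 per unit of rank matches 30 per unit of black height; 133 is (100 + 3) + 2 * 15, using
   [height t <= rb_rank t]. *)
move=> okt; have := @split_amortized int disp K color (@rb_join K) (@rb K)
  (@rb_rank K) 15 100 isT isT _ _ _ _ t k okt.
case: (tree_split _ _ _) => [[[tl b] tr] w].
rewrite /value /work /= => H; have hh := rb_height okt; case: H.
- by move=> u; rewrite rb_rankE; have := bh_gt0 u; lia.
- move=> l d m r /= /and4P[hred /eqP hbh rbl rbr]; rewrite !rb_rankE /=.
  by case: d hred => [/andP[/negbTE-> /negbTE->]|_]; split=> //=; lia.
- move=> l d m r u /= /and4P[hred /eqP hbh rbl rbr]; rewrite !rb_rankE => hu.
  have hub : (bh u <= bh r)%N by lia.
  rewrite /rb_join !costE; case: ifP => h1; first by lia.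
  case: ifP => h2; rewrite ?costE.
    have [] := rb_join_left_spec m rbr hub.
    move: (rb_join_left u m r) => [j wj]; rewrite /value /work /= => hj hd hw.
    case: ifP => [hj2|_] /=.
      2: by clear hd; case: d hred => [/andP[_ /negbTE hr]|_]; split; lia.
    (* Since [r] is red, [d] is black, and both the parent and the blackened join have rank
       [2 * bh r]. *)
    have hr : is_red r by apply: contraT => hr; have := hd hr h2; rewrite hj2.
    have := bh_blacken (proj1 (andP hj2)).
    have := work_blacken j; rewrite /value /work => hb1 [hb2 hb3] {hd hj2}.
    by case: d hred => [/andP[_ /negbTE hr2]|_]; split; lia.
  by case: ifP => hc; case: d hred => hred; rewrite ?costE /=; split; lia.
- move=> l d m r u /= /and4P[hred /eqP hbh rbl rbr]; rewrite !rb_rankE => hu.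
  have hub : (bh u <= bh l)%N by lia.
  rewrite /rb_join !costE; case: ifP => h1; rewrite ?costE.
    have [] := rb_join_right_spec m rbl hub.
    move: (rb_join_right l m u) => [j wj]; rewrite /value /work /= => hj hd hw.
    case: ifP => [hj2|_] /=.
      2: by clear hd; case: d hred => [/andP[/negbTE hl _]|_]; split; lia.
    have hl : is_red l by apply: contraT => hl; have := hd hl h1; rewrite hj2.
    have := bh_blacken (proj1 (andP hj2)).
    have := work_blacken j; rewrite /value /work => hb1 [hb2 hb3] {hd hj2}.
    by case: d hred => [/andP[/negbTE hl2 _]|_]; split; lia.
  case: ifP => h2; first by lia.
  by case: ifP => hc; case: d hred => hred; rewrite ?costE /=; split; lia.
- by move=> h1 h2 h3; split=> //; lia.
Qed.

(** * From linear bounds in heights and ranks to logarithms of the size *)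

Lemma ltn_sqr n : (2 <= n)%N -> (n < n ^ 2)%N.
Proof. by move=> n2; rewrite -mulnn ltn_Pmull // ltnW. Qed.

(** For [n >= 2], [n.+1 <= n ^ 2] turns [2 ^ e <= n.+1] into [e * ln 2 <= 2 * ln n]; [n.+1] stands
    for a weight. *)
Lemma work_le_ln (R : realType) (A B : nat) : exists C : R,
  forall n e w : nat, (2 <= n)%N -> (2 ^ e <= n.+1)%N -> (w <= A + B * e)%N ->
  w%:R <= C * ln n%:R.
Proof.
exists ((A + B * 2)%:R / ln 2) => n e w n2 hen hw.
have l2 : 0 < ln 2 :> R by rewrite ln_gt0// ltr1n.
have hn : ln 2 <= ln n%:R :> R by rewrite ler_ln ?posrE ?ltr0n ?ler_nat// ltnW.
have he : e%:R * ln 2 <= 2 * ln n%:R :> R.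
  have n0 : (0 < n)%N by exact: ltnW.
  rewrite [leLHS]mulr_natl [leRHS]mulr_natl -!lnXn ?ltr0n//.
  rewrite ler_ln ?posrE ?exprn_gt0 ?ltr0n// -!natrX ler_nat.
  by apply: leq_trans hen (ltn_sqr n2).
have hw' : w%:R <= A%:R + B%:R * e%:R :> R by rewrite -natrM -natrD ler_nat.
rewrite mulrAC ler_pdivlMr// (le_trans (ler_wpM2r (ltW l2) hw'))//.
rewrite natrD natrM mulrDl [leRHS]mulrDl lerD//.
  by rewrite ler_wpM2l.
by rewrite -!mulrA ler_wpM2l.
Qed.

Lemma avl_split_work (R : realType) : split_log_work R avl avl_join.
Proof.
(* With [e = (height t)./2] the height is at most [2 e + 1], whence 61 = 1 + 60 and 120 = 2 * 60. *)
have [C HC] := work_le_ln R 61 120; exists C, 2 => disp K t k _ ok n2.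
apply: HC (n2) (avl_height (n := (height t)./2) ok _) _.
  by rewrite -[leqRHS]odd_double_half leq_addl.
have := avl_split_bound k ok.
by case: (tree_split _ _ _) => [[[? ?] ?] w] [_ _]; rewrite /work /=; lia.
Qed.

Lemma rb_split_work (R : realType) : split_log_work R rb rb_join.
Proof.
(* With [e = bh t - 1] the rank is at most [2 e + 1], whence 134 = 1 + 133 and 266 = 2 * 133. *)
have [C HC] := work_le_ln R 134 266; exists C, 2 => disp K t k _ ok n2.
apply: HC (n2) (rb_weight ok) _.
have := rb_split_bound k ok; have := bh_gt0 t; rewrite rb_rankE.
by case: (tree_split _ _ _) => [[[? ?] ?] w] ? [_ _]; rewrite /work /=; lia.
Qed.

(** * In-order sequence of split, and ranks depending on the size alone *)

Section SplitInorder.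
Variables (disp : Order.disp_t) (K : orderType disp) (D : Type).
Variable join : tree D K -> K -> tree D K -> M (tree D K).
Hypothesis inorder_join : forall a m b,
  inorder (value (join a m b)) = inorder a ++ m :: inorder b.

(** Serves twice: the sizes bound [log_rank], and in a treap the keys of both outputs come from [t]
    and so obey its priority bounds. *)
Lemma inorder_split t k :
  let: (tl, b, tr) := value (tree_split join t k) in
  inorder t = inorder tl ++ nseq b k ++ inorder tr.
Proof.
elim: t => //= l IHl d m r IHr; rewrite !costE.
case: eqVneq => [->//|_]; rewrite ?costE.
case: (k < m)%O; rewrite ?costE.
  case: (tree_split join l k) IHl => [[[ll b] lr] w]; rewrite /value /= => ->.
  by rewrite inorder_join -!catA.
case: (tree_split join r k) IHr => [[[rl b] rr] w]; rewrite /value /= => ->.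
by rewrite inorder_join -!catA.
Qed.

Lemma split_log_rank_le t k : split_rank_le join (@log_rank D K) t k.
Proof.
rewrite /split_rank_le; have := inorder_split t k.
case: (tree_split join t k) => [[[tl b] tr] w]; rewrite /value /= => h.
have := congr1 size h.
rewrite !size_cat !size_inorder => hs.
by split; rewrite /log_rank lerD2r lez_nat leq_up_log // /weight; lia.
Qed.

End SplitInorder.

(** * Weight-balanced trees, with the logarithm of the weight as potential *)

#[local] Arguments rotate_left : simpl never.
#[local] Arguments rotate_right : simpl never.

Section WeightBalanced.
Variables (R : realType) (alpha : R).
Hypothesis alpha_range : 2 / 11 < alpha <= 1 - 1 / Num.sqrt 2.

Lemma alpha_gt0 : 0 < alpha.
Proof. by case/andP: alpha_range; lra. Qed.

(** The upper bound on [alpha] gives [1 - alpha >= 1 / sqrt 2], so [(1 - alpha)^2] is at least 1/2,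
    which exceeds [alpha]. *)
Lemma alpha_window : alpha < 1 / 2 /\ alpha <= (1 - alpha) ^+ 2.
Proof.
case/andP: alpha_range => h1 h2.
have s0 : 0 < Num.sqrt 2 :> R by rewrite sqrtr_gt0.
have ss : Num.sqrt 2 ^+ 2 = 2 :> R by rewrite sqr_sqrtr.
have hi : (1 / Num.sqrt 2) ^+ 2 = 1 / 2 :> R by rewrite expr_div_n ss expr1n.
have i0 : 0 < 1 / Num.sqrt 2 :> R by rewrite divr_gt0.
move: (1 / Num.sqrt 2) hi i0 h2 => y hi i0 h2; rewrite expr2 in hi *.
by split; nra.
Qed.

(** A child has at most the fraction [1 - alpha] of its parent's weight, so [lnw] drops by at least
    this much per level. *)
Definition wb_delta : R := - ln (1 - alpha).
(* 17 bounds the work of one level of [wb_join_left] and [wb_join_right]. *)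
Definition wb_slope : R := 17 / wb_delta.
(** Where the descent ends, at a cost of 3, [lnw t - lnw t1] may be as low as
    [ln (alpha / (1 - alpha))]. *)
Definition wb_base : R := 3 - wb_slope * ln (alpha / (1 - alpha)).

Section Join.
Variable K : Type.
Implicit Types t : tree unit K.

Lemma inorder_wb_join_right t1 k t2 :
  inorder (value (wb_join_right alpha t1 k t2)) = inorder t1 ++ k :: inorder t2.
Proof.
elim: t1 => /= [|l _ [] k' c IHc]; rewrite !costE; case: ifP => _ //.
rewrite ?costE -catA /= -IHc; case: ifP => _ //.
move: (value (wb_join_right _ _ _ _)) => [//|l1 [] k1 r1]; rewrite ?costE.
by case: ifP => _; rewrite ?(inorder_rotate_left, costE) //=
  inorder_rotate_right.
Qed.

Lemma inorder_wb_join_left t1 k t2 :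
  inorder (value (wb_join_left alpha t1 k t2)) = inorder t1 ++ k :: inorder t2.
Proof.
elim: t2 => /= [|c IHc [] k' r _]; rewrite !costE; case: ifP => _ //.
rewrite ?costE -cat_cons catA -IHc; case: ifP => _ //.
move: (value (wb_join_left _ _ _ _)) => [//|l1 [] k1 r1]; rewrite ?costE.
by case: ifP => _; rewrite ?(inorder_rotate_right, costE) //=
  inorder_rotate_left.
Qed.

Lemma inorder_wb_join t1 k t2 :
  inorder (value (wb_join alpha t1 k t2)) = inorder t1 ++ k :: inorder t2.
Proof.
rewrite /wb_join !costE; case: ifP => // _; case: ifP => _.
  exact: inorder_wb_join_right.
exact: inorder_wb_join_left.
Qed.

Lemma weight_wb_join t1 k t2 :
  weight (value (wb_join alpha t1 k t2)) = (weight t1 + weight t2)%N.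
Proof.
by rewrite /weight -!size_inorder inorder_wb_join size_cat /=; lia.
Qed.

Definition lnw t : R := ln (weight t)%:R.

Lemma weightR_gt0 t : 0 < (weight t)%:R :> R.
Proof. by rewrite ltr0n. Qed.

Lemma likeE (a b : nat) : (0 < a)%N -> (0 < b)%N -> like alpha a b =
  (alpha * b%:R <= (1 - alpha) * a%:R) && (alpha * a%:R <= (1 - alpha) * b%:R).
Proof.
move=> a0 b0; rewrite /like.
rewrite ler_pdivlMr ?ltr0n ?addn_gt0 ?a0// ler_pdivrMr ?ltr0n ?addn_gt0 ?a0//.
by rewrite natrD; congr andb; apply/idP/idP; lra.
Qed.

Lemma wb_node (l : tree unit K) d k r : wb alpha (Node l d k r) =
  [&& like alpha (weight l) (weight r), wb alpha l & wb alpha r].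
Proof. by rewrite [LHS]/= weight_node. Qed.

Lemma wb_delta_gt0 : 0 < wb_delta.
Proof.
have [a2 _] := alpha_window; have a0 := alpha_gt0.
by rewrite oppr_gt0 ln_lt0// subr_gt0; lra.
Qed.

Lemma lnw_child t t' : (weight t)%:R <= (1 - alpha) * (weight t')%:R ->
  lnw t <= lnw t' - wb_delta.
Proof.
have [a2 _] := alpha_window; have := weightR_gt0 t' => w0 h.
rewrite /wb_delta opprK addrC -lnM ?posrE//; last by lra.
by rewrite ler_ln ?posrE ?weightR_gt0// mulr_gt0//; lra.
Qed.

Lemma like_sym (a b : nat) : (0 < a)%N -> (0 < b)%N ->
  like alpha a b = like alpha b a.
Proof. by move=> a0 b0; rewrite !likeE // andbC. Qed.

Lemma wb_slope_gt0 : 0 < wb_slope.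
Proof. by rewrite divr_gt0 ?wb_delta_gt0. Qed.

Lemma wb_base_le (t1 t : tree unit K) :
  alpha * (weight t1)%:R <= (1 - alpha) * (weight t)%:R ->
  3 <= wb_slope * (lnw t - lnw t1) + wb_base.
Proof.
have [a2 _] := alpha_window; have a0 := alpha_gt0; have c0 := wb_slope_gt0.
move=> h; have : ln (alpha / (1 - alpha)) <= lnw t - lnw t1.
  rewrite /lnw -ln_div ?posrE ?weightR_gt0//.
  rewrite ler_ln ?posrE ?divr_gt0 ?weightR_gt0//; last by lra.
  by rewrite ler_pdivlMr ?weightR_gt0// mulrAC ler_pdivrMr; lra.
by rewrite -(ler_pM2l c0) /wb_base; lra.
Qed.

(* [alpha <= (1 - alpha)^2] is what prevents a single step down from jumping
   over the window of weights that are in balance with [t1]. *)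
Lemma wb_descend (t1 x y t : tree unit K) :
  weight t = (weight x + weight y)%N ->
  like alpha (weight x) (weight y) ->
  alpha * (weight t1)%:R <= (1 - alpha) * (weight t)%:R ->
  ~~ like alpha (weight t1) (weight t) ->
  alpha * (weight t1)%:R <= (1 - alpha) * (weight x)%:R /\
  17 + wb_slope * (lnw x - lnw t1) <= wb_slope * (lnw t - lnw t1).
Proof.
have [a2 aw] := alpha_window; have a0 := alpha_gt0; have d0 := wb_delta_gt0.
move=> hw; rewrite !likeE // => /andP[h1 h2] inv.
rewrite inv andbT -ltNge; move: (inv); rewrite hw natrD => inv' far.
split.
  (* Balance gives [weight x >= alpha * weight t], which by [far] exceeds [(1 - alpha) * weight t1];
     multiply by [1 - alpha] and use [aw]. *)
  by have := weightR_gt0 t1; rewrite expr2 in aw; nra.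
have wlt : (weight x)%:R <= (1 - alpha) * (weight t)%:R :> R.
  by rewrite hw natrD; lra.
have cd : wb_slope * wb_delta = 17 by rewrite /wb_slope divfK ?gt_eqF.
by have := lnw_child wlt; rewrite -(ler_pM2l wb_slope_gt0); lra.
Qed.

Lemma wb_join_left_work (t1 : tree unit K) k t2 : wb alpha t2 ->
  alpha * (weight t1)%:R <= (1 - alpha) * (weight t2)%:R ->
  (work (wb_join_left alpha t1 k t2))%:R <=
  wb_slope * (lnw t2 - lnw t1) + wb_base.
Proof.
elim: t2 => [|l IHl d k' r _] wb2 inv.
  by rewrite /= !costE; case: ifP => _; rewrite ?costE; apply: wb_base_le.
have [stop|far] := boolP (like alpha (weight t1) (weight (Node l d k' r))).
  by rewrite /= !costE stop ?costE; apply: wb_base_le.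
have step : (work (wb_join_left alpha t1 k (Node l d k' r)) <=
             17 + work (wb_join_left alpha t1 k l))%N.
  rewrite /= !costE; case: ifP => _; rewrite ?costE; first by lia.
  case: ifP => _; rewrite ?costE; first by lia.
  move: (value (wb_join_left alpha t1 k l)) => [|l1 [] k1 r1]; rewrite ?costE.
    by lia.
  have := @work_rotate_left unit K; have := @work_rotate_right unit K => rr rl.
  by case: ifP => _; rewrite !work_bind ?value_bind ?costE;
    have := rr (Node (Node l1 tt k1 r1) tt k' r); have := rl (Node l1 tt k1 r1);
    have := rr (Node (value (rotate_left (Node l1 tt k1 r1))) tt k' r); lia.
move: wb2; rewrite wb_node => /and3P[hlike wbl _].
have [/(IHl wbl) IH hc] := wb_descend (weight_node l d k' r) hlike inv far.
rewrite -(ler_nat R) natrD in step; apply: le_trans step _.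
by lra.
Qed.

Lemma wb_join_right_work t1 k (t2 : tree unit K) : wb alpha t1 ->
  alpha * (weight t2)%:R <= (1 - alpha) * (weight t1)%:R ->
  (work (wb_join_right alpha t1 k t2))%:R <=
  wb_slope * (lnw t1 - lnw t2) + wb_base.
Proof.
elim: t1 => [|l _ d k' r IHr] wb1 inv.
  by rewrite /= !costE; case: ifP => _; rewrite ?costE; apply: wb_base_le.
have [stop|far] := boolP (like alpha (weight (Node l d k' r)) (weight t2)).
  by rewrite /= !costE stop ?costE; apply: wb_base_le.
have step : (work (wb_join_right alpha (Node l d k' r) k t2) <=
             17 + work (wb_join_right alpha r k t2))%N.
  rewrite /= !costE; case: ifP => _; rewrite ?costE; first by lia.
  case: ifP => _; rewrite ?costE; first by lia.
  move: (value (wb_join_right alpha r k t2)) => [|l1 [] k1 r1]; rewrite ?costE.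
    by lia.
  have := @work_rotate_left unit K; have := @work_rotate_right unit K => rr rl.
  by case: ifP => _; rewrite !work_bind ?value_bind ?costE;
    have := rl (Node l tt k' (Node l1 tt k1 r1)); have := rr (Node l1 tt k1 r1);
    have := rl (Node l tt k' (value (rotate_right (Node l1 tt k1 r1)))); lia.
move: wb1; rewrite wb_node like_sym // => /and3P[hlike _ wbr].
rewrite like_sym // in far.
have hw : weight (Node l d k' r) = (weight r + weight l)%N.
  by rewrite weight_node addnC.
have [/(IHr wbr) IH hc] := wb_descend hw hlike inv far.
rewrite -(ler_nat R) natrD in step; apply: le_trans step _.
by lra.
Qed.

Lemma lnw_ge0 t : 0 <= lnw t.
Proof. by rewrite ln_ge0 // ler1n. Qed.

Lemma lnw_le t t' : (lnw t <= lnw t') = (weight t <= weight t')%N.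
Proof. by rewrite ler_ln ?posrE ?weightR_gt0 // ler_nat. Qed.

Lemma wb_base_ge3 : 3 <= wb_base.
Proof.
have [a2 _] := alpha_window.
have := @wb_base_le Leaf Leaf; rewrite subrr mulr0 add0r; apply.
by rewrite ler_wpM2r //; lra.
Qed.

(** The weight of a join is the sum of the weights whatever rotations occur. As [u] is no heavier
    than the sibling [l] of [r], it is not too heavy for [r], which is the invariant of the descent.
    The 2 pays for the reads in [wb_join]. *)
Lemma wb_join_into_right l d m r u : wb alpha (Node l d m r) ->
  lnw u <= lnw l -> let j := wb_join alpha u m r in
  lnw (value j) <= lnw (Node l d m r) /\
  (work j)%:R + wb_slope * lnw u <= wb_slope * lnw (value j) + (wb_base + 2).
Proof.
rewrite wb_node likeE // lnw_le => /and3P[/andP[h1 h2] wbl wbr] hu /=.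
rewrite lnw_le weight_wb_join weight_node leq_add2r; split => //.
have [a2 _] := alpha_window; have a0 := alpha_gt0; have b3 := wb_base_ge3.
have hj x : (weight x <= weight u + weight r)%N ->
    wb_slope * lnw x <= wb_slope * lnw (value (wb_join alpha u m r)).
  by move=> hx; rewrite ler_pM2l ?wb_slope_gt0// lnw_le weight_wb_join.
have := hj u (leq_addr _ _); have := hj r (leq_addl _ _) => {hj}.
move: (lnw (value _)) => lj hjr hju.
have inv : alpha * (weight u)%:R <= (1 - alpha) * (weight r)%:R.
  by apply: le_trans h2; rewrite ler_pM2l // ler_nat.
rewrite /wb_join !costE; case: ifP => hlike; rewrite ?costE; first by lra.
move: hlike; rewrite likeE // inv andbT => /negbT; rewrite -ltNge => far.
(* By [far] and [alpha < 1/2], [u] is lighter than [r], so descending into [u] is excluded. *)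
case: ifP => [hru|_].
  by move: hru; rewrite -(ltr_nat R) => hru; have := weightR_gt0 r; nra.
by have := wb_join_left_work m wbr inv; rewrite !natrD; lra.
Qed.

Lemma wb_join_into_left l d m r u : wb alpha (Node l d m r) ->
  lnw u <= lnw r -> let j := wb_join alpha l m u in
  lnw (value j) <= lnw (Node l d m r) /\
  (work j)%:R + wb_slope * lnw u <= wb_slope * lnw (value j) + (wb_base + 2).
Proof.
rewrite wb_node likeE // lnw_le => /and3P[/andP[h1 h2] wbl wbr] hu /=.
rewrite lnw_le weight_wb_join weight_node leq_add2l; split => //.
have [a2 _] := alpha_window; have a0 := alpha_gt0; have b3 := wb_base_ge3.
have hj x : (weight x <= weight l + weight u)%N ->
    wb_slope * lnw x <= wb_slope * lnw (value (wb_join alpha l m u)).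
  by move=> hx; rewrite ler_pM2l ?wb_slope_gt0// lnw_le weight_wb_join.
have := hj l (leq_addr _ _); have := hj u (leq_addl _ _) => {hj}.
move: (lnw (value _)) => lj hju hjl.
have inv : alpha * (weight u)%:R <= (1 - alpha) * (weight l)%:R.
  by apply: le_trans h1; rewrite ler_pM2l // ler_nat.
rewrite /wb_join !costE; case: ifP => hlike; rewrite ?costE; first by lra.
move: hlike; rewrite likeE // inv /= => /negbT; rewrite -ltNge => far.
case: ifP => [_|/negbT hul].
  by have := wb_join_right_work m wbl inv; rewrite !natrD; lra.
move: hul; rewrite -leqNgt -(ler_nat R) => hul; have := weightR_gt0 u; nra.
Qed.

Lemma wb_height t : wb alpha t -> wb_delta * (height t)%:R <= lnw t.
Proof.
have d0 := wb_delta_gt0; have a0 := alpha_gt0.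
elim: t => [_|l IHl d k r IHr]; first by rewrite mulr0 lnw_ge0.
rewrite wb_node likeE // => /and3P[/andP[h1 h2] /IHl hl /IHr hr].
have := @lnw_child l (Node l d k r); have := @lnw_child r (Node l d k r).
rewrite weight_node natrD => cr cl.
rewrite [height _]/= -natr1 mulrDr mulr1 -lerBrDr natr_max.
by rewrite maxEle; case: ifP => _; lra.
Qed.

End Join.

Lemma wb_split_work : split_log_work R (wb alpha) (wb_join alpha).
Proof.
have d0 := wb_delta_gt0; have s0 := wb_slope_gt0.
have b3 : 3 <= wb_base := wb_base_ge3 unit.
have l2 : 0 < ln 2 :> R by rewrite ln_gt0// ltr1n.
set b := (wb_base + 2 + 3) / wb_delta.
(* The summands pay for the 1, the height (through [wb_height]) and the two output potentials, each
   at most [lnw t]; the outer factor 2 comes from [lnw t <= 2 * ln n]. *)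
exists (1 / ln 2 + 2 * (b + 2 * wb_slope)), 2 => disp K t k _ ok n2.
have c'0 : 0 <= wb_base + 2 by lra.
have := @split_amortized R disp K unit (@wb_join R alpha K) (@wb R alpha K)
  (@lnw K) wb_slope (wb_base + 2) (ltW s0) c'0 (@lnw_ge0 K) _
  (@wb_join_into_right K) (@wb_join_into_left K) t k ok.
case: (tree_split _ _ _) => [[[tl e] tr] w] H.
have {H} [|hl hr hw] := H.
  move=> l d m r; rewrite wb_node => /and3P[_ -> ->].
  by rewrite !lnw_le weight_node leq_addr leq_addl.
have hn : ln 2 <= ln (tree_size t)%:R :> R.
  by rewrite ler_ln ?posrE ?ltr0n ?ler_nat// ltnW.
have one : 1 <= 1 / ln 2 * ln (tree_size t)%:R :> R.
  by rewrite mulrAC ler_pdivlMr // !mul1r.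
have hh : (wb_base + 2 + 3) * (height t)%:R <= b * lnw t.
  rewrite /b mulrAC ler_pdivlMr // -mulrA ler_wpM2l //; first by lra.
  by rewrite mulrC wb_height.
have b0 : 0 <= b by rewrite divr_ge0 //; lra.
have hlnw : lnw t <= 2 * ln (tree_size t)%:R.
  have n0 : (0 < tree_size t)%N by exact: ltnW.
  rewrite mulr_natl -lnXn ?ltr0n// ler_ln ?posrE ?exprn_gt0 ?ltr0n//.
  by rewrite -natrX ler_nat ltn_sqr.
have hb : (b + 2 * wb_slope) * lnw t <=
          (b + 2 * wb_slope) * (2 * ln (tree_size t)%:R).
  by rewrite ler_wpM2l //; lra.
have hs : wb_slope * (lnw tl + lnw tr) <= wb_slope * (2 * lnw t).
  by rewrite ler_pM2l //; lra.
by apply: le_trans hw _; lra.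
Qed.

End WeightBalanced.

(** * Treaps: work of split in terms of records of the priorities *)

Section TreapSplit.
Variables (R : realType) (disp : Order.disp_t) (K : orderType disp).
Variable p : K -> R.
Implicit Types t : tree unit K.

(** One step of the nested fixpoint, with the inner [fix] folded back into [treap_join]. *)
Lemma treap_joinE t1 k t2 : treap_join p t1 k t2 =
  let* b1 := op (prior p k t1) in
  let* b2 := op (prior p k t2) in
  if b1 && b2 then node t1 tt k t2 else
  match t1, t2 with
  | Leaf, Leaf => node t1 tt k t2
  | Node l1 _ k1 r1, Leaf =>
      let* _ := tick 1 in
      let* r := treap_join p r1 k t2 in
      node l1 tt k1 r
  | Leaf, Node l2 _ k2 r2 =>
      let* _ := tick 1 in
      let* l := treap_join p t1 k l2 in
      node l tt k2 r2
  | Node l1 _ k1 r1, Node l2 _ k2 r2 =>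
      let* _ := tick 2 in
      let* b := op (p k2 <= p k1) in
      if b then
        let* r := treap_join p r1 k t2 in
        node l1 tt k1 r
      else
        let* l := treap_join p t1 k l2 in
        node l tt k2 r2
  end.
Proof. by case: t1 => [|????]; case: t2. Qed.

Lemma treap_join_prior t1 k t2 : prior p k t1 -> prior p k t2 ->
  treap_join p t1 k t2 = (Node t1 tt k t2, 3%N).
Proof. by move=> h1 h2; rewrite treap_joinE h1 h2. Qed.

Lemma inorder_treap_join t1 k t2 :
  inorder (value (treap_join p t1 k t2)) = inorder t1 ++ k :: inorder t2.
Proof.
elim: t1 t2 => [|l1 _ [] k1 r1 IH1]; elim=> [|l2 IH2 [] k2 r2 _];
  rewrite treap_joinE !costE //; case: ifP => _ //; rewrite ?costE /=.
- by rewrite IH2.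
- by rewrite IH1 -catA.
- case: ifP => _; rewrite ?costE /=; first by rewrite IH1 -catA.
  by rewrite IH2 /= -catA.
Qed.

(** A uniform priority is above level [l] with probability [2 ^- l]. Level 0 admits every real, so
    counting can start there for arbitrary priorities. *)
Definition above (l : nat) (x : R) : bool := (l == 0)%N || (1 - 2 ^- l <= x).

(* Weak records of the priorities, observed through the levels
   [1 - 2^-l <= x] only: [l] is a level already reached by an earlier entry. *)
Fixpoint records (l : nat) (xs : seq R) : nat :=
  if xs is x :: xs' then
    if above l x then (records (above l.+1 x + l) xs').+1 else records l xs'
  else 0%N.

Lemma above_le l x y : above l x -> x <= y -> above l y.
Proof. by case: l => //= l /le_trans; apply. Qed.

(** Every level gained before [m] was reached by an entry at most [m], so [m] is still above the
    current level and counts. The strict inequality pays for one node of the search path. *)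
Lemma records_max l xs m ys : above l m -> all (fun x => x <= m) xs ->
  (records l xs < records l (xs ++ m :: ys))%N.
Proof.
elim: xs l => [|x xs IH] l lm /=; first by rewrite lm.
move=> /andP[xm hxs]; case: ifP => _; last exact: IH.
rewrite ltnS; apply: IH => //.
by case: (boolP (above l.+1 x)) => // /above_le; apply.
Qed.

Lemma all_prior k t : all (fun x => p x <= p k) (inorder t) -> prior p k t.
Proof. by case: t => //= l _ x r; rewrite all_cat /= => /and3P[]. Qed.

(** At a node [m] with [k < m], the keys of the left subtree above [k] are read before [m] and have
    priority at most that of [m], so [m] adds a record; the other side is symmetric. A level costs 3
    in split and 3 in its join, the last one at most 2. *)
Lemma treap_split_work t k : bst t -> treap p t ->
  (work (tree_split (treap_join p) t k) <=
   6 * (records 0 [seq p x | x <- rev [seq x <- inorder t | (x < k)%O]] +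
        records 0 [seq p x | x <- inorder t & (k < x)%O]) + 2)%N.
Proof.
have stepR w a b b' : (w <= 6 * (a + b) + 2)%N -> (b < b')%N ->
    (1 + (1 + (1 + (w + (3 + 0)))) <= 6 * (a + b') + 2)%N by lia.
have stepL w a a' b : (w <= 6 * (a + b) + 2)%N -> (a < a')%N ->
    (1 + (1 + (1 + (w + (3 + 0)))) <= 6 * (a' + b) + 2)%N by lia.
rewrite /bst !lt_sorted_pairwise; elim: t => [//|l IHl d m r IHr] /=.
rewrite pairwise_cat /= allrel_consr => /and3P[/andP[lm _] pl /andP[mr pr]].
rewrite all_cat => /and3P[/andP[plm prm] tl tr]; rewrite !costE.
case: eqVneq => [_|km]; rewrite !costE; first exact: leq_addl.
have [{}km|mk] := ltP k m; rewrite ?costE.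
  have rN : [seq x <- inorder r | (x < k)%O] = [::].
    apply/eqP; rewrite -(negbK (_ == _)) -has_filter; apply/hasPn => x xr.
    by rewrite -leNgt ltW // (lt_trans km) // (allP mr).
  rewrite !filter_cat /= km (lt_gtF km) rN cats0 map_cat /=.
  have := IHl pl tl; have := inorder_split inorder_treap_join l k.
  case: (tree_split _ l k) => [[[ll b] lr] w]; rewrite /value /work /= => eql hw.
  (* The keys of [lr] come from [l], so [m] dominates both arguments and the join is immediate. *)
  have plr : prior p m lr.
    by apply: all_prior; move: plm; rewrite eql !all_cat => /and3P[].
  rewrite treap_join_prior ?(all_prior prm) // /work /=.
  have hall : all (fun x => x <= p m) [seq p x | x <- inorder l & (k < x)%O].
    rewrite all_map all_filter; apply/allP => x /(allP plm) /= ->.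
    by rewrite implybT.
  exact: stepR hw (records_max _ (isT : above 0 (p m)) hall).
have {}km : (m < k)%O by rewrite lt_neqAle eq_sym km.
have lN : [seq x <- inorder l | (k < x)%O] = [::].
  apply/eqP; rewrite -(negbK (_ == _)) -has_filter; apply/hasPn => x xl.
  by rewrite -leNgt ltW // (lt_trans _ km) // (allP lm).
rewrite !filter_cat /= km (lt_gtF km) lN rev_cat rev_cons -cats1 -catA map_cat /=.
have := IHr pr tr; have := inorder_split inorder_treap_join r k.
case: (tree_split _ r k) => [[[rl b] rr] w]; rewrite /value /work /= => eqr hw.
have prl : prior p m rl.
  by apply: all_prior; move: prm; rewrite eqr !all_cat => /and3P[].
rewrite treap_join_prior ?(all_prior plm) // /work /=.
have hall : all (fun x => x <= p m)
    [seq p x | x <- rev [seq x <- inorder r | (x < k)%O]].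
  rewrite all_map all_rev all_filter; apply/allP => x /(allP prm) /= ->.
  by rewrite implybT.
exact: stepL hw (records_max _ (isT : above 0 (p m)) hall).
Qed.

End TreapSplit.

(** * Tail bound for the records of independent uniform priorities *)

Section Records.
Context (d : measure_display) (Omega : measurableType d) (R : realType).
Variables (P : probability Omega R) (I : eqType) (X : I -> {RV P >-> R}).

Lemma measurable_pre i (B : set R) : measurable B -> measurable (X i @^-1` B).
Proof. by move=> mB; rewrite -[_ @^-1` _]setTI; exact: measurable_funPT. Qed.

Lemma above_pred l (x : R) : above l.+1 x -> above l x.
Proof.
case: l => // l; apply: le_trans; rewrite lerD2l lerN2.
by rewrite lef_pV2 ?posrE ?exprn_gt0 // ler_weXn2l // ler1n.
Qed.

Lemma measurable_above l : measurable [set x : R | above l x].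
Proof.
case: l => [|l].
  by rewrite (_ : [set x | _] = setT) //; apply/seteqP; split.
rewrite (_ : [set x | _] = `[1 - 2 ^- l.+1, +oo[%classic).
  exact: measurable_itv.
by apply/seteqP; split => x /=; rewrite in_itv /= andbT.
Qed.

Lemma prob_above i l : uniform01 (X i) ->
  P (X i @^-1` [set x | above l x]) = (2 ^- l)%:E.
Proof.
move=> u; have := u _ (measurable_above l).
rewrite /distribution /pushforward => ->; case: l => [|l].
  by rewrite /uniform_prob integral_uniform_pdf1 ?ltr01 // expr0 invr1.
rewrite /uniform_prob integral_uniform_pdf.
have p0 : 0 < 2 ^- l.+1 :> R by rewrite invr_gt0 exprn_gt0.
have p1 : 2 ^- l.+1 <= 1 :> R by rewrite invf_le1 ?exprn_gt0 // exprn_ege1 // ler1n.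
rewrite (_ : _ `&` _ = `[1 - 2 ^- l.+1, 1]%classic); last first.
  apply/seteqP; split => x /=; rewrite !in_itv /= /above /=.
    by move=> [-> /andP[_ ->]].
  by move=> /andP[h1 ->]; rewrite h1; split => //; rewrite andbT; lra.
rewrite (eq_integral (fun=> 1%:E)); last first.
  move=> x; rewrite inE /= in_itv /= /uniform_pdf => /andP[h1 ->].
  by rewrite andbT subr0 invr1 ifT //; lra.
rewrite integral_cst //= lebesgue_measure_itv /= lte_fin ifT; last by lra.
by rewrite mul1e -EFinB; congr EFin; lra.
Qed.

Definition many_records (J : seq I) (l m : nat) : set Omega :=
  [set w | (m <= records l [seq X i w | i <- J])%N].

Lemma many_records_cons i J l m : many_records (i :: J) l m.+1 =
  (X i @^-1` (~` [set x | above l x]) `&` many_records J l m.+1) `|`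
  ((X i @^-1` ([set x | above l x] `\` [set x | above l.+1 x]) `&` many_records J l m) `|`
   (X i @^-1` [set x | above l.+1 x] `&` many_records J l.+1 m)).
Proof.
apply/seteqP; split => w /=; rewrite /many_records /=.
  case: (boolP (above l (X i w))) => hl; last by left.
  case: (boolP (above l.+1 (X i w))) => hl' /=.
    by rewrite add1n ltnS => h; right; right.
  by rewrite add0n ltnS => h; right; left; split=> //; split=> //; apply/negP.
move=> [[/negP/negbTE-> //]|[[[-> /negP/negbTE->]]|[h]]] //=.
by rewrite (above_pred h) h.
Qed.

Lemma measurable_many_records J l m : measurable (many_records J l m).
Proof.
elim: J l m => [|i J IH] l [|m].
- by rewrite (_ : many_records _ _ _ = setT); [exact: measurableT|apply/seteqP; split].
- by rewrite (_ : many_records _ _ _ = set0); [exact: measurable0|apply/seteqP; split].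
- by rewrite (_ : many_records _ _ _ = setT); [exact: measurableT|apply/seteqP; split].
rewrite many_records_cons; apply: measurableU.
  apply: measurableI => //; apply: measurable_pre; apply: measurableC.
  exact: measurable_above.
apply: measurableU; apply: measurableI => //; apply: measurable_pre.
  by apply: measurableD; exact: measurable_above.
exact: measurable_above.
Qed.

(** [A] collects the conditions on the entries already read; the product form does the work of
    conditioning on [A] without a division. *)
Definition indep_of (A : set Omega) (J : seq I) : Prop :=
  measurable A /\
  forall J0 : seq I, uniq J0 -> {subset J0 <= J} ->
  forall B : I -> set R, (forall i, i \in J0 -> measurable (B i)) ->
    P (A `&` \big[setI/setT]_(i <- J0) (X i @^-1` B i)) =
    (P A * \big[*%E/1]_(i <- J0) P (X i @^-1` B i))%E.

Lemma indep_of_setT s J : mutually_independent s X -> {subset J <= s} ->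
  indep_of setT J.
Proof.
move=> ind sub; split=> [|J0 uJ0 sJ0 B mB]; first exact: measurableT.
rewrite setTI probability_setT mul1e; apply: ind => // x /sJ0; exact: sub.
Qed.

Lemma indep_of_step A i J B : indep_of A (i :: J) -> i \notin J ->
  measurable B ->
  P (A `&` X i @^-1` B) = (P A * P (X i @^-1` B))%E /\
  indep_of (A `&` X i @^-1` B) J.
Proof.
move=> [mA ind] iJ mB.
have e : P (A `&` X i @^-1` B) = (P A * P (X i @^-1` B))%E.
  have := ind [:: i] isT _ (fun=> B) (fun _ _ => mB).
  by rewrite !big_seq1; apply => x; rewrite !inE => ->.
split=> //; split=> [|J0 uJ0 sJ0 C mC].
  by apply: measurableI => //; exact: measurable_pre.
(* Independence is applied to [i :: J0] with the events of [C] extended by [B] at [i]. *)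
pose C' j := if j == i then B else C j.
have CC' j : j \in J0 -> C' j = C j.
  by move=> /sJ0 jJ; rewrite /C'; case: eqP => // ji; rewrite ji (negbTE iJ) in jJ.
have iJ0 : i \notin J0 by apply: contra iJ; exact: sJ0.
have Ci : C' i = B by rewrite /C' eqxx.
have := ind (i :: J0) _ _ C' _; rewrite !big_cons /= iJ0 uJ0 Ci.
rewrite (eq_big_seq (fun j => X j @^-1` C j)); last by move=> j /CC' ->.
rewrite [in X in _ -> _ -> _ -> _ = X](eq_big_seq (fun j => P (X j @^-1` C j)));
  last by move=> j /CC' ->.
rewrite setIA muleA -e; apply=> // [j|j].
  by rewrite !inE => /orP[->//|/sJ0->]; rewrite orbT.
by rewrite inE /C'; case: eqP => //= _; exact: mC.
Qed.

Lemma prob_not_above i l : uniform01 (X i) ->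
  P (X i @^-1` (~` [set x | above l x])) = (1 - 2 ^- l)%:E.
Proof.
move=> u; rewrite preimage_setC probability_setC ?prob_above //.
exact: measurable_pre (measurable_above l).
Qed.

Lemma prob_level i l : uniform01 (X i) ->
  P (X i @^-1` ([set x | above l x] `\` [set x | above l.+1 x])) =
  (2 ^- l / 2)%:E.
Proof.
move=> u; have mpre := fun l => measurable_pre i (measurable_above l).
have fin : (P (X i @^-1` [set x | above l x]) < +oo)%E.
  by rewrite prob_above // ltry.
have -> : P (X i @^-1` ([set x | above l x] `\` [set x | above l.+1 x])) =
    (P (X i @^-1` [set x | above l x]) - P (X i @^-1` [set x | above l x] `&`
     X i @^-1` [set x | above l.+1 x]))%E.
  exact: measureD (mpre l) (mpre l.+1) fin.
rewrite setIidr; last by move=> w /=; exact: above_pred.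
rewrite !prob_above // -EFinB; congr EFin.
by rewrite exprS invfM; lra.
Qed.

(** Below level [L] the first term reproduces itself exactly: with [q = 2 ^- l], the three cases for
    the next entry give [(1 - q) * 3/4 + q/2 + q/2 * 1/2 = 3/4]. The second term is a union bound
    for entries that reach level [L]. *)
Lemma prob_many_records (A : set Omega) J l m L : indep_of A J -> uniq J ->
  {in J, forall i, uniform01 (X i)} -> (l <= L)%N ->
  (P (A `&` many_records J l m) <=
   P A * (2 ^+ (L - l) * (3 / 4) ^+ m + (size J)%:R * 2 ^- L)%:E)%E.
Proof.
have e0 : 0 <= 2 ^- L :> R by rewrite invr_ge0 exprn_ge0.
have x1 k (y : R) : 0 <= y -> 1 <= 2 ^+ k * (3 / 4) ^+ 0 + y.
  by move=> y0; rewrite expr0 mulr1 ler_wpDr // exprn_ege1 // ler1n.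
have init (A' : set Omega) (J' : seq I) l' (x : R) : measurable A' -> 1 <= x ->
    (P (A' `&` many_records J' l' 0) <= P A' * x%:E)%E.
  move=> mA hx; rewrite (_ : many_records _ _ _ = setT); last by apply/seteqP; split.
  by rewrite setIT -[leLHS]mule1 lee_wpmul2l // lee_fin.
elim: J A l m => [|i J IH] A l [|m] indA uJ unif lL;
  have mA := proj1 indA;
  have /fineK PA : P A \is a fin_num by exact: fin_num_measure.
- by apply: init => //; apply: x1; rewrite mulr_ge0.
- rewrite (_ : many_records _ _ _ = set0); last by apply/seteqP; split.
  by rewrite setI0 measure0 mule_ge0 // lee_fin addr_ge0 ?mulr_ge0 ?exprn_ge0.
- by apply: init => //; apply: x1; rewrite mulr_ge0.
case/andP: uJ => iJ uJ.
have ui : uniform01 (X i) by apply: unif; rewrite mem_head.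
have {}unif : {in J, forall j, uniform01 (X j)}.
  by move=> j jJ; apply: unif; rewrite inE jJ orbT.
have mS l' := measurable_above l'.
have mI (B : set R) (C : set Omega) : measurable B -> measurable C ->
    measurable (A `&` (X i @^-1` B `&` C)).
  by move=> mB mC; do 2?apply: measurableI => //; exact: measurable_pre.
have split_step (B : set R) l' m' : measurable B -> (l' <= L)%N ->
    (P (A `&` (X i @^-1` B `&` many_records J l' m')) <= P A * P (X i @^-1` B) *
     (2 ^+ (L - l') * (3 / 4) ^+ m' + (size J)%:R * 2 ^- L)%:E)%E.
  move=> mB l'L; have [<- ind'] := indep_of_step indA iJ mB.
  by rewrite setIA; exact: IH.
set q : R := 2 ^- l; set z : R := (3 / 4) ^+ m; set n : R := (size J)%:R.
have z0 : 0 <= z by rewrite exprn_ge0.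
have n0 : 0 <= n by [].
have a0 : 0 <= fine (P A) by rewrite fine_ge0.
have q0 : 0 <= q by rewrite invr_ge0 exprn_ge0.
have sJ : (size (i :: J))%:R = n + 1 :> R by rewrite /= -natr1.
have b1 := split_step _ l m.+1 (measurableC (mS l)) lL.
rewrite prob_not_above // -PA -!EFinM in b1.
have [lL'|] := ltnP l L.
  have b2 := split_step _ l m (measurableD (mS l) (mS l.+1)) lL.
  have b3 := split_step _ l.+1 m (mS l.+1) lL'.
  rewrite prob_level // -PA -!EFinM in b2.
  rewrite prob_above // -PA -!EFinM in b3.
  rewrite many_records_cons !setIUr.
  apply: le_trans (measureU2 _ _ _) _.
  + by apply: mI; [exact: measurableC|exact: measurable_many_records].
  + apply: measurableU; apply: mI => //; try exact: measurable_many_records.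
    exact: measurableD.
  apply: le_trans (leeD b1 (le_trans (measureU2 _ _ _) (leeD b2 b3))) _.
  + by apply: mI; [exact: measurableD|exact: measurable_many_records].
  + by apply: mI => //; exact: measurable_many_records.
  rewrite -!EFinD -PA -EFinM lee_fin sJ.
  have -> : 2 ^+ (L - l) = 2 * 2 ^+ (L - l.+1) :> R by rewrite -exprS -subSn.
  have -> : 2 ^- l.+1 = q / 2 :> R by rewrite exprS invfM mulrC.
  rewrite [in leLHS]exprS [in leRHS]exprS -/z -/q.
  have : 0 <= fine (P A) * 2 ^- L by rewrite mulr_ge0.
  by lra.
move=> Ll; have {Ll lL} eL : l = L by apply/eqP; rewrite eqn_leq lL Ll.
have [b2 _] := indep_of_step indA iJ (mS l).
rewrite prob_above // -PA -EFinM in b2.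
move: b2 => /eqP; rewrite eq_le => /andP[b2 _].
(* At level [L] an entry above it is given up as a failure; its probability [2 ^- L] is the share of
   [i] in the second term. *)
have sub : A `&` many_records (i :: J) l m.+1 `<=`
    (A `&` (X i @^-1` (~` [set x | above l x]) `&` many_records J l m.+1)) `|`
    (A `&` X i @^-1` [set x | above l x]).
  rewrite many_records_cons => w [Aw] [[h1 h2]|[[[h1 _] _]|[h1 _]]]; first by left.
    by right.
  by right; split=> //; exact: above_pred h1.
have mN := mI _ _ (measurableC (mS l)) (measurable_many_records J l m.+1).
have mY : measurable (A `&` X i @^-1` [set x | above l x]).
  by apply: measurableI => //; exact: measurable_pre.
apply: le_trans (le_measure _ _ _ sub) _; rewrite ?inE.
- by apply: measurableI => //; exact: measurable_many_records.
- exact: measurableU.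
apply: le_trans (measureU2 _ mN mY) _.
apply: le_trans (leeD b1 b2) _.
rewrite -EFinD -PA -EFinM lee_fin sJ exprS -/z -/q eL subnn expr0 -eL -/q.
have : 0 <= fine (P A) * q * (z * 3 / 4 + n * q).
  by rewrite !mulr_ge0 // addr_ge0 // ?mulr_ge0.
by lra.
Qed.

End Records.

(** * High-probability bound for treaps *)

(* With [m = 6 L] both terms of [prob_many_records] are at most [n 2^-L], because
   [(3/4)^6 < 1/4]; then [2^L >= n^(q+3)] makes the failure polynomially small. *)
Lemma failure_bound (R : realType) (q n a L : nat) (c : R) : (2 <= n)%N ->
  (n <= 2 ^ a)%N -> c <= q%:R -> L = ((q + 3) * a)%N ->
  2 * (2 ^+ L * (3 / 4) ^+ (6 * L) + n%:R * 2 ^- L) <= n%:R `^ (- c) :> R.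
Proof.
move=> n2 na cq eL; have nR2 : 2 <= n%:R :> R by rewrite ler_nat.
have nR0 : 0 < n%:R :> R by rewrite ltr0n ltnW.
have h1 : 2 ^+ L * (3 / 4) ^+ (6 * L) <= 2 ^- L :> R.
  rewrite exprM -exprMn -exprVn lerXn2r ?nnegrE ?mulr_ge0 ?exprn_ge0 //.
  by rewrite !exprS expr0; lra.
have h2 : 2 ^- L <= n%:R ^- (q + 3) :> R.
  rewrite lef_pV2 ?posrE ?exprn_gt0 // eL mulnC exprM.
  by rewrite lerXn2r ?nnegrE ?exprn_ge0 // -natrX ler_nat.
have h3 : n%:R ^- (q + 3) = n%:R ^- q / (n%:R * n%:R * n%:R) :> R.
  by rewrite exprD invfM !exprS expr0 mulr1 mulrA.
have h4 : n%:R ^- q <= n%:R `^ (- c) :> R.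
  by rewrite -powR_mulrn // -powRN ler_powR ?lerN2 // (le_trans _ nR2) // ler1n.
apply: le_trans h4; have z0 : 0 <= n%:R ^- q :> R by rewrite invr_ge0 exprn_ge0.
(* The left side of the goal is at most [2 * (1 + n) * n ^- (q + 3)], and
   [2 * (1 + n) <= 4 * n <= n ^ 3] as [n >= 2]. *)
have h5 : n%:R ^- q / (n%:R * n%:R * n%:R) * (4 * n%:R) <= n%:R ^- q :> R.
  rewrite mulrAC ler_pdivrMr ?mulr_gt0 // ler_wpM2l //.
  by rewrite ler_wpM2r // (le_trans _ (ler_pM _ _ nR2 nR2)) // -natrM.
have h6 : n%:R * 2 ^- L <= n%:R * n%:R ^- (q + 3) :> R by rewrite ler_wpM2l.
have h7 : 0 <= n%:R ^- (q + 3) :> R by rewrite invr_ge0 exprn_ge0.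
by rewrite -h3 in h5; nra.
Qed.

(** Both record sequences are read off the sorted keys [s], so one event, chosen before the tree,
    serves every treap on [s]. *)
Lemma treap_split_whp (R : realType) (c : R) : 0 < c ->
  exists (C : R) (n0 : nat),
  forall (disp : Order.disp_t) (K : orderType disp)
    (d : measure_display) (Omega : measurableType d)
    (P : probability Omega R)
    (s : seq K) (X : K -> {RV P >-> R}) (k : K),
    sorted <%O s ->
    {in s, forall x, uniform01 (X x)} ->
    mutually_independent s X ->
    (n0 <= size s)%N ->
    exists E : set Omega,
      [/\ measurable E,
          ((1 - (size s)%:R `^ (- c))%:E <= P E)%E
        & forall (omega : Omega) (t : tree unit K), E omega ->
            inorder t = s -> treap (fun x => X x omega) t ->
            (work (tree_split (treap_join (fun x => X x omega)) t k))%:R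
              <= C * ln (size s)%:R].
Proof.
move=> c0; pose q := Num.bound c.
have cq : c <= q%:R by rewrite ltW // archi_boundP // ltW.
(* Fewer than [6 * L] records on each side give at most [72 * L + 2] units of work, where
   [L = (q + 3) * (a.-1 + 1)] and [a.-1] is the exponent [e]. *)
have [C HC] := work_le_ln R (72 * (q + 3) + 2) (72 * (q + 3)).
exists C, 2 => disp K d Omega P s X k ss unif ind n2.
pose a := up_log 2 (size s).
have /andP[ha1 ha2] : (2 ^ a.-1 < size s <= 2 ^ a)%N by exact: up_log_bounds.
have a0 : (0 < a)%N by rewrite lt0n up_log_eq0 /=; lia.
pose L := ((q + 3) * a)%N.
pose J1 := rev [seq x <- s | (x < k)%O]; pose J2 := [seq x <- s | (k < x)%O].
pose F J := many_records X J 0 (6 * L).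
have us : uniq s by exact: lt_sorted_uniq ss.
pose eps : R := 2 ^+ L * (3 / 4) ^+ (6 * L) + (size s)%:R * 2 ^- L.
have bound J : {subset J <= s} -> uniq J -> (size J <= size s)%N ->
    (P (F J) <= eps%:E)%E.
  move=> sub uJ szJ.
  have := @prob_many_records _ _ _ P _ X setT J 0 (6 * L) L (indep_of_setT ind sub) uJ.
  rewrite setTI probability_setT mul1e subn0 => /(_ _ isT) h.
  apply: le_trans (h _) _; first by move=> i /sub; exact: unif.
  by rewrite lee_fin lerD2l ler_wpM2r // ?invr_ge0 ?exprn_ge0 // ler_nat.
have mF J : measurable (F J) by exact: measurable_many_records.
have mU : measurable (F J1 `|` F J2) by exact: measurableU.
exists (~` (F J1 `|` F J2)); split.
- exact: measurableC.
- rewrite probability_setC // EFinB leeB //.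
  apply: le_trans (measureU2 _ (mF J1) (mF J2)) _.
  have b1 : (P (F J1) <= eps%:E)%E.
    apply: bound.
    + by move=> x; rewrite mem_rev mem_filter => /andP[].
    + by rewrite rev_uniq filter_uniq.
    + by rewrite size_rev size_filter count_size.
  have b2 : (P (F J2) <= eps%:E)%E.
    apply: bound.
    + by move=> x; rewrite mem_filter => /andP[].
    + by rewrite filter_uniq.
    + by rewrite size_filter count_size.
  apply: le_trans (leeD b1 b2) _; rewrite -EFinD lee_fin.
  by have := failure_bound n2 ha2 cq (erefl L); rewrite -/eps; lra.
move=> omega t /not_orP[/negP nF1 /negP nF2] ts tt.
apply: HC n2 (leqW (ltnW ha1)) _.
have bt : bst t by rewrite /bst ts.
apply: leq_trans (treap_split_work k bt tt) _; rewrite ts.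
move: nF1 nF2; rewrite -!ltnNge.
have arith r1 r2 : (r1 < 6 * L)%N -> (r2 < 6 * L)%N ->
    (6 * (r1 + r2) + 2 <= 72 * (q + 3) + 2 + 72 * (q + 3) * a.-1)%N.
  have -> : (72 * (q + 3) + 2 + 72 * (q + 3) * a.-1 = 72 * L + 2)%N.
    by rewrite /L -{2}(prednK a0) mulnS; lia.
  by lia.
exact: arith.
Qed.

Theorem theorem2 (R : realType) :
  [/\ (* AVL trees *)
      split_log_work R avl avl_join /\
      (forall (disp : Order.disp_t) (K : orderType disp)
          (t : tree unit K) (k : K),
        bst t -> avl t -> split_rank_le (@avl_join K) (@avl_rank K) t k),
      (* red-black trees *)
      split_log_work R rb rb_join /\
      (forall (disp : Order.disp_t) (K : orderType disp)
          (t : tree color K) (k : K),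
        bst t -> rb t -> split_rank_le (@rb_join K) (@rb_rank K) t k),
      (* weight-balanced trees *)
      forall alpha : R, 2 / 11 < alpha <= 1 - 1 / Num.sqrt 2 ->
        split_log_work R (wb alpha) (wb_join alpha) /\
        (forall (disp : Order.disp_t) (K : orderType disp)
            (t : tree unit K) (k : K),
          bst t -> wb alpha t ->
          split_rank_le (@wb_join R alpha K) (@log_rank unit K) t k)
    & (* treaps *)
      (forall c : R, 0 < c ->
        exists (C : R) (n0 : nat),
        forall (disp : Order.disp_t) (K : orderType disp)
          (d : measure_display) (Omega : measurableType d)
          (P : probability Omega R)
          (s : seq K) (X : K -> {RV P >-> R}) (k : K),
          sorted <%O s ->
          {in s, forall x, uniform01 (X x)} ->
          mutually_independent s X ->
          (n0 <= size s)%N ->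
          exists E : set Omega,
            [/\ measurable E,
                ((1 - (size s)%:R `^ (- c))%:E <= P E)%E
              & forall (omega : Omega) (t : tree unit K), E omega ->
                  inorder t = s -> treap (fun x => X x omega) t ->
                  (work (tree_split (treap_join (fun x => X x omega)) t k))%:R
                    <= C * ln (size s)%:R]) /\
      (forall (disp : Order.disp_t) (K : orderType disp) (p : K -> R)
          (t : tree unit K) (k : K),
        bst t -> treap p t ->
        split_rank_le (treap_join p) (@log_rank unit K) t k)].
Proof.
split.
- split=> [|disp K t k _ ok]; first exact: avl_split_work.
  rewrite /split_rank_le; have := avl_split_bound k ok.
  case: (value _) => [[tl b] tr] [h1 h2 _].
  by rewrite /avl_rank !lerD2r !lez_nat.
- split=> [|disp K t k _ ok]; first exact: rb_split_work.
  rewrite /split_rank_le; have := rb_split_bound k ok.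
  by case: (value _) => [[tl b] tr] [].
- move=> alpha ha; split=> [|disp K t k _ _]; first exact: wb_split_work.
  exact: split_log_rank_le (@inorder_wb_join R alpha K) t k.
- split=> [c|disp K p t k _ _]; first exact: treap_split_whp.
  exact: split_log_rank_le (@inorder_treap_join R disp K p) t k.
Qed.
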